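(* Let $f:\mathbb{R}\to\mathbb{R}$ be a continuous function which is strictly convex or strictly concave, and let $A\subset\mathbb{R}$ be a finite set. Then $$|A+f(A)|\gg\frac{|A|^{24/19}}{(\log|A|)^{2/19}}.$$
   Context: $f(A)=\{f(a):a\in A\}$, $X+Y=\{x+y:x\in X,y\in Y\}$. $X\gg Y$ means $X\ge cY$ for some absolute constant $c>0$. Logarithms are to base 2. *)

(* Defs.v *)
From mathcomp Require Import all_boot all_order all_algebra finmap.
From mathcomp Require Import all_classical all_reals all_analysis.

Set Implicit Arguments.
Unset Strict Implicit.
Unset Printing Implicit Defensive.

Import Order.TTheory GRing.Theory Num.Theory.
Import numFieldNormedType.Exports.

Local Open Scope ring_scope.

Definition strictly_convex (R : realType) (f : R -> R) : Prop :=
  forall x y t : R, x != y -> 0 < t < 1 ->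
    f (t * x + (1 - t) * y) < t * f x + (1 - t) * f y.

Definition strictly_concave (R : realType) (f : R -> R) : Prop :=
  forall x y t : R, x != y -> 0 < t < 1 ->
    t * f x + (1 - t) * f y < f (t * x + (1 - t) * y).

Definition image_fset (R : realType) (f : R -> R) (A : {fset R}) : {fset R} :=
  [fset f a | a in A]%fset.

Definition sumset (R : realType) (X Y : {fset R}) : {fset R} :=
  [fset (x + y)%R | x in X, y in Y]%fset.

Definition log2 (R : realType) (x : R) : R := ln x / ln 2.

(* Main.v *)
(* A strictly convex f makes the differences (a - b, f a - f b), a <> b, pairwise distinct, and
   after passing to one side of a minimum of f on A it is monotone, so that the translates of the
   graph of f by points (t, c) are chains that share at most one point. Such chains satisfy the
   Szemeredi-Trotter bound, by cutting the grid into axis-parallel cells. With Z, W equal to A,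
   f(A) in either order, n = |A|, S = Z + W and m = |S|, this bounds the number of t with at least
   k representations in Z - Z by O(n m^2 / k^3), and in S - Z by O(m^4 / (n k^3)). Hence the cubic
   energy of Z is O(n m^2 log n) and sum_t |Z /\ (Z - t)| |S /\ (S - t)| is O(m^(5/2)). The
   Schoen-Shkredov inequality, applied to the t with few representations in Z - Z, turns these into
   E(Z)^3 = O(m^(13/2) log n), while Cauchy-Schwarz gives max(E(Z), E(W)) >= n^4 / m. *)
Require Import Defs.
From mathcomp Require Import all_boot all_order all_algebra finmap.
From mathcomp Require Import zify ring lra.
From mathcomp Require Import all_classical all_reals all_analysis.
Set Implicit Arguments.
Unset Strict Implicit.
Unset Printing Implicit Defensive.
Import Order.TTheory GRing.Theory Num.Theory.
Import numFieldNormedType.Exports.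

Local Open Scope nat_scope.

(** * Cauchy-Schwarz in [nat], and power sums controlled by level sets *)

(** Induction on [s]: the cross term satisfies [(x * X) ^ 2 <= (y * Z) * (Y * z)], so AM-GM bounds
    [2 * (x * X)] by [y * Z + Y * z]. *)
Lemma sum_cauchy_schwarz (I : Type) (s : seq I) (a b c : I -> nat) :
  (forall i, a i ^ 2 <= b i * c i) ->
  (\sum_(i <- s) a i) ^ 2 <= (\sum_(i <- s) b i) * (\sum_(i <- s) c i).
Proof.
move=> le_abc; elim: s => [|i s IHs]; first by rewrite !big_nil.
rewrite !big_cons; move: (le_abc i) IHs.
move: (a i) (b i) (c i) (\sum_(_ <- s) a _) (\sum_(_ <- s) b _)
  (\sum_(_ <- s) c _) => x y z X Y Z le_xyz le_XYZ.
suff : 2 * (x * X) <= y * Z + Y * z by lia.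
rewrite -leq_sqr; apply: leq_trans (_ : 4 * ((y * Z) * (Y * z)) <= _).
  have : x ^ 2 * X ^ 2 <= (y * z) * (Y * Z) by apply: leq_mul.
  by lia.
by rewrite nat_AGM2.
Qed.

Section Levels.
Variables (I : Type) (s : seq I) (q : I -> nat) (M : nat).
Hypothesis tail : forall k, k ^ 3 * (\sum_(i <- s) (k <= q i)) <= M.

(** Dyadic decomposition: if [2 ^ k] is the largest power of 2 below a positive [q i], then
    [q i ^ 3 <= 8 * (2 ^ k) ^ 3], and [tail] bounds each level by [8 * M]. *)
Lemma sum_cube_le (n : nat) : (forall i, q i <= n) ->
  \sum_(i <- s) q i ^ 3 <= 8 * M * (trunc_log 2 n).+1.
Proof.
move=> le_qn.
have le_q i : q i ^ 3 <= \sum_(k < (trunc_log 2 n).+1) 8 * (2 ^ k) ^ 3 * (2 ^ k <= q i).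
  have [->|q_gt0] := posnP (q i); first by rewrite exp0n.
  have lt_k : trunc_log 2 (q i) < (trunc_log 2 n).+1.
    by rewrite ltnS; apply: leq_trunc_log.
  rewrite (bigD1 (Ordinal lt_k)) //= trunc_logP // muln1.
  apply: leq_trans (leq_addr _ _).
  have := trunc_log_ltn (q i) (isT : 1 < 2).
  rewrite expnS => /ltnW; rewrite -(leq_exp2r _ _ (isT : 0 < 3)).
  by rewrite expnMn.
apply: leq_trans (leq_sum _ (fun i _ => le_q i)) _.
rewrite exchange_big /=.
have -> : 8 * M * (trunc_log 2 n).+1 = \sum_(k < (trunc_log 2 n).+1) 8 * M.
  by rewrite sum_nat_const card_ord mulnC.
apply: leq_sum => k _; rewrite -big_distrr /= -mulnA.
by rewrite leq_mul2l tail.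
Qed.

(** Doubling the threshold: the range from [d] to [2 * d] adds at most [4 * M] to the left side by
    [tail], and the induction hypothesis at [2 * d], halved, gives the other [4 * M]. *)
Lemma sum_sqr_high (n d : nat) : (forall i, q i <= n) -> 0 < d ->
  d * \sum_(i <- s | d <= q i) q i ^ 2 <= 8 * M.
Proof.
move=> le_qn d_gt0; have [k] := ubnP (n.+1 - d).
elim: k d d_gt0 => // k IHk d d_gt0 lt_k.
have [lt_nd|le_dn] := ltnP n d.
  rewrite big1 ?muln0 // => i le_dq.
  by have := leq_trans lt_nd le_dq; rewrite ltnNge le_qn.
have IH : 2 * d * \sum_(i <- s | 2 * d <= q i) q i ^ 2 <= 8 * M.
  by apply: IHk; lia.
have split_sum : \sum_(i <- s | d <= q i) q i ^ 2 <=
    4 * d ^ 2 * \sum_(i <- s) (d <= q i) + \sum_(i <- s | 2 * d <= q i) q i ^ 2.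
  rewrite big_mkcond [X in _ <= _ + X]big_mkcond big_distrr -big_split /=.
  apply: leq_sum => i _; case: ifP => le_dq; case: ifP => le_2dq //; nia.
have := tail d; move: split_sum IH.
set F := \sum_(i <- s | d <= q i) q i ^ 2; set N := \sum_(i <- s) _.
set G := \sum_(i <- s | _) q i ^ 2.
move=> le_F le_G le_N.
have : 2 * d * F <= 2 * d * (4 * d ^ 2 * N + G) by rewrite leq_mul2l le_F orbT.
by rewrite mulnDr; lia.
Qed.
End Levels.

(** * Representation counts, additive energies and double counting *)

Section Correlation.
Local Open Scope fset_scope.
Local Open Scope nat_scope.
Variable G : zmodType.
Implicit Types (X Y Z W S T U : {fset G}) (t : G).

(** The number of representations of [t] as [y - x], which is also the size of the intersection of
    [X + t] and [Y]. *)
Definition corr X Y t : nat := \sum_(x <- X) ((x + t)%R \in Y).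

(** The cubic energy of [X] once [T] contains [X - X]; the finite index set [T] keeps the sum finite
    in an arbitrary group. *)
Definition energy3 T X := \sum_(t <- T) corr X X t ^ 3.

Lemma sum_fset_shift X Y t (F : G -> nat) :
  (forall y, y \in Y -> (y + t)%R \in X) ->
  \sum_(x <- X) ((x - t)%R \in Y) * F x = \sum_(y <- Y) F (y + t)%R.
Proof.
move=> sYX; have -> : \sum_(x <- X) ((x - t)%R \in Y) * F x =
    \sum_(x <- [seq x <- X | (x - t)%R \in Y]) F x.
  rewrite big_filter [RHS]big_mkcond /=.
  by apply: eq_bigr => x _; case: (_ \in Y); rewrite ?mul1n.
have perm_X : perm_eq [seq x <- X | (x - t)%R \in Y] [seq (y + t)%R | y <- Y].
  apply: uniq_perm.
  - by rewrite filter_uniq // fset_uniq.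
  - by rewrite map_inj_uniq ?fset_uniq //; apply: addIr.
  move=> x; rewrite mem_filter; apply/andP/mapP => [[xY _]|[y yY ->]].
    by exists (x - t)%R => //; rewrite subrK.
  by rewrite addrK; split=> //; apply: sYX.
by rewrite (perm_big _ perm_X) big_map.
Qed.

(** The pairs of [X] and [Y] are sorted by their difference. *)
Lemma sum_corr T X Y (F : G -> nat) :
  (forall x y, x \in X -> y \in Y -> (y - x)%R \in T) ->
  \sum_(t <- T) corr X Y t * F t = \sum_(x <- X) \sum_(y <- Y) F (y - x)%R.
Proof.
move=> sT.
under eq_bigr => t _ do rewrite /corr big_distrl /=.
rewrite exchange_big /=; apply: eq_big_seq => x xX.
rewrite -(@sum_fset_shift T Y (- x)%R F) => [|y yY]; last exact: sT.
by apply: eq_bigr => t _; rewrite opprK addrC.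
Qed.

Lemma sum_corr1 X Y T :
  (forall x y, x \in X -> y \in Y -> (y - x)%R \in T) ->
  \sum_(t <- T) corr X Y t = #|` X| * #|` Y|.
Proof.
move=> sT; have := sum_corr (fun=> 1) sT.
under eq_bigr do rewrite muln1.
move=> ->; rewrite !sum1_size.
by rewrite big_const_seq count_predT iter_addn_0 mulnC.
Qed.

Lemma corr_le X Y t : corr X Y t <= #|` X|.
Proof.
rewrite /corr -sum1_size.
by apply: leq_sum => x _; case: (_ \in _).
Qed.

Lemma card_corr X Y t : #|` [fset x in X | (x + t)%R \in Y]| = corr X Y t.
Proof.
rewrite -sum1_size /corr big_fset /= -big_mkcondr.
by rewrite [RHS]big_mkcond [LHS]big_mkcond /=; apply: eq_bigr => x _; case: (_ \in Y).
Qed.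

Lemma sum_fset_sep X (P : pred G) (F : G -> nat) :
  \sum_(x <- [fset x in X | P x]) F x = \sum_(x <- X) P x * F x.
Proof.
rewrite big_fset /= big_mkcond /=.
by apply: eq_bigr => x _; case: (P x); rewrite ?mul1n.
Qed.

(** Both sides count the quadruples with [y - x = y' - x'], equivalently [y' - y = x' - x]. *)
Lemma sum_corr_sqr T X Y :
  (forall x y, x \in X -> y \in Y -> (y - x)%R \in T) ->
  \sum_(t <- T) corr X Y t ^ 2 = \sum_(x <- X) \sum_(x' <- X) corr Y Y (x' - x)%R.
Proof.
move=> sT; under eq_bigr => t _ do rewrite -mulnn.
rewrite sum_corr //; apply: eq_bigr => x _.
rewrite /corr exchange_big /=; apply: eq_bigr => x' _; apply: eq_bigr => y _.
by rewrite addrCA.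
Qed.

(** Cauchy-Schwarz for [rep u], the number of ways to write [u] as [x + y]: its sum is the number of
    pairs, and its second moment is the additive energy of [X] and [Y]. *)
Lemma card_sumset_energy X Y U :
  (forall x y, x \in X -> y \in Y -> (x + y)%R \in U) ->
  (#|` X| * #|` Y|) ^ 2 <=
    #|` U| * \sum_(x <- X) \sum_(x' <- X) corr Y Y (x' - x)%R.
Proof.
move=> sU.
pose rep u := \sum_(x <- X) ((u - x)%R \in Y).
have sum_rep (F : G -> nat) :
    \sum_(u <- U) rep u * F u = \sum_(x <- X) \sum_(y <- Y) F (y + x)%R.
  under eq_bigr => u _ do rewrite big_distrl /=.
  rewrite exchange_big /=; apply: eq_big_seq => x xX.
  by apply: sum_fset_shift => y yY; rewrite addrC sU.
have -> : #|` X| * #|` Y| = \sum_(u <- U) rep u.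
  have := sum_rep (fun=> 1); under eq_bigr do rewrite muln1.
  by move=> ->; rewrite !sum1_size big_const_seq count_predT iter_addn_0 mulnC.
apply: leq_trans (@sum_cauchy_schwarz _ _ _ (fun=> 1) (fun u => rep u ^ 2) _) _.
  by move=> u; rewrite mul1n.
rewrite sum1_size leq_mul2l; apply/orP; right.
under eq_bigr => u _ do rewrite -mulnn.
rewrite sum_rep [leqRHS]exchange_big /=.
apply: leq_sum => x _; rewrite /rep exchange_big /=; apply: leq_sum => x' _.
by rewrite /corr; apply: leq_sum => y _; rewrite addrA.
Qed.

(** * The Schoen-Shkredov inequality *)

Section SchoenShkredov.
Variables Z W S T : {fset G}.
Hypothesis sum_ZW : forall z w, z \in Z -> w \in W -> (z + w)%R \in S.
Hypothesis sub_ZZ : forall z z', z \in Z -> z' \in Z -> (z' - z)%R \in T.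

Let slice t := [fset z in Z | (z + t)%R \in Z].
(** The additive energy of [slice t] and [W]: the number of solutions of [b - a = w' - w]. *)
Let slice_energy t := \sum_(a <- slice t) \sum_(b <- slice t) corr W W (b - a)%R.

(* Katz-Koester: slice t + W is contained in the intersection of S and S - t. *)
Lemma slice_energy_ge t :
  (#|` W| * corr Z Z t) ^ 2 <= corr S S t * slice_energy t.
Proof.
have := @card_sumset_energy (slice t) W [fset s in S | (s + t)%R \in S].
rewrite !card_corr [_ * #|` W|]mulnC; apply=> x y.
rewrite !inE /= => /andP[xZ xtZ] yW.
by rewrite sum_ZW //= addrAC sum_ZW.
Qed.

(** For fixed [a] and [b] in [Z], the shifts [t] whose slice contains both correspond, through
    [c = a + t], to the representations of [b - a] in [Z - Z]. *)
Lemma sum_slice_energy :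
  \sum_(t <- T) slice_energy t = \sum_(t <- T) corr Z Z t ^ 2 * corr W W t.
Proof.
transitivity (\sum_(a <- Z) \sum_(b <- Z) corr Z Z (b - a)%R * corr W W (b - a)%R);
  last first.
  rewrite -(sum_corr (fun t => corr Z Z t * corr W W t) sub_ZZ).
  by apply: eq_bigr => t _; rewrite mulnA.
rewrite /slice_energy.
under eq_bigr => t _.
  rewrite sum_fset_sep; under eq_bigr => a _ do rewrite sum_fset_sep big_distrr.
  over.
rewrite exchange_big; apply: eq_big_seq => a aZ /=.
rewrite exchange_big; apply: eq_big_seq => b bZ /=.
under eq_bigr => t _ do rewrite mulnA.
rewrite -big_distrl /=; congr (_ * _).
rewrite /corr.
under eq_bigr => t _ do
  rewrite -[X in (X + t)%R \in Z]opprK addrC -mulnC mulnC.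
rewrite (@sum_fset_shift T Z (- a)%R (fun t => ((b + t)%R \in Z) : nat)); last first.
  by move=> y yZ; apply: sub_ZZ.
by apply: eq_bigr => c _; rewrite addrCA.
Qed.

(** Write [q] for [corr Z Z t]. For [q < d], multiplying the Katz-Koester bound by [q ^ 2 <= d * q]
    splits the square of each term into a factor [d * q * corr S S t] and a factor [slice_energy t],
    as Cauchy-Schwarz requires. *)
Lemma low_energy_le d :
  (#|` W| * \sum_(t <- T | corr Z Z t < d) corr Z Z t ^ 2) ^ 2 <=
    d * (\sum_(t <- T) corr Z Z t * corr S S t) *
    (\sum_(t <- T) corr Z Z t ^ 2 * corr W W t).
Proof.
rewrite -sum_slice_energy big_mkcond big_distrr [d * _]big_distrr /=.
apply: sum_cauchy_schwarz => t; case: ifP => lt_d; last by rewrite muln0.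
have := slice_energy_ge t.
move: (corr Z Z t) lt_d (corr S S t) (slice_energy t) => q lt_d s e le_q.
have -> : (#|` W| * q ^ 2) ^ 2 = q * q * (#|` W| * q) ^ 2 by lia.
have -> : d * (q * s) * e = d * q * (s * e) by lia.
by apply: leq_mul => //; rewrite leq_mul2r (ltnW lt_d) orbT.
Qed.
End SchoenShkredov.
End Correlation.

(** * Incidences between chains and an integer grid *)

(* A chain meets at most 2r of the r * r cells, since u + v separates the cells it meets. *)
Lemma chain_same_cell (I : finType) (T : {set I}) (u v : I -> nat) (r : nat) :
  {in T &, forall i j, u i < u j -> v i <= v j} ->
  {in T, forall i, u i < r} -> {in T, forall i, v i < r} ->
  #|T| ^ 2 <= 2 * r * \sum_(i in T) \sum_(j in T) ((u i == u j) && (v i == v j)).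
Proof.
move=> mono_uv lt_ur lt_vr.
have -> : #|T| = \sum_(k < 2 * r) \sum_(i in T) (u i + v i == k).
  rewrite exchange_big -sum1_card; apply: eq_bigr => i iT /=.
  have lt_k : u i + v i < 2 * r by have := lt_ur i iT; have := lt_vr i iT; lia.
  rewrite (bigD1 (Ordinal lt_k)) //= eqxx big1 // => k neq_k.
  by apply/eqP; rewrite eqb0; apply: contra neq_k => /eqP eq_k; apply/eqP/val_inj.
apply: leq_trans (@sum_cauchy_schwarz _ _ _ (fun=> 1)
  (fun k : 'I__ => (\sum_(i in T) (u i + v i == k)) ^ 2) _) _.
  by move=> k; rewrite mul1n.
rewrite sum1_card card_ord leq_mul2l; apply/orP; right.
under eq_bigr => k _ do rewrite -mulnn big_distrl /=.
rewrite exchange_big /=; apply: leq_sum => i iT.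
under eq_bigr => k _ do rewrite big_distrr /=.
rewrite exchange_big /=; apply: leq_sum => j jT.
have [eq_uv|neq_uv] := eqVneq (u i + v i) (u j + v j); last first.
  rewrite big1 // => k _; case: eqP => // eq_i; case: eqP => // eq_j.
  by rewrite eq_i eq_j eqxx in neq_uv.
(* If [u i < u j], then [v i <= v j] and the sums would differ; so equal sums force equal cells. *)
have -> : (u i == u j) && (v i == v j).
  by have := mono_uv i j iT jT; have := mono_uv j i jT iT; lia.
have lt_k : u i + v i < 2 * r by have := lt_ur i iT; have := lt_vr i iT; lia.
rewrite (bigD1 (Ordinal lt_k)) //= big1 ?addn0; first by case: (_ == _); case: (_ == _).
move=> k neq_k; suff /negPf -> : u i + v i != k by [].
by apply: contra neq_k => /eqP eq_k; apply/eqP/val_inj.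
Qed.

(** A pair in a common block is determined by its first entry and the residue of the second modulo
    [w]. *)
Lemma card_same_block (p w : nat) : 0 < w ->
  #|[set q : 'I_p * 'I_p | q.1 %/ w == q.2 %/ w]| <= p * w.
Proof.
move=> w_gt0.
pose code (q : 'I_p * 'I_p) := (q.1, Ordinal (ltn_pmod q.2 w_gt0)).
have -> : p * w = #|{: 'I_p * 'I_w}| by rewrite card_prod !card_ord.
rewrite -(card_in_imset (f := code)) ?max_card //.
move=> [a b] [a' b']; rewrite !inE /= => /eqP eq_ab /eqP eq_ab' [eq_a eq_b].
rewrite -eq_a; congr (_, _); apply: val_inj => /=.
by rewrite (divn_eq b w) (divn_eq b' w) -eq_ab -eq_ab' eq_a eq_b.
Qed.

(* Incidence bound in the form of Szemeredi-Trotter for chains in a p1 * p2 grid, two of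
   which never share two points. *)
Lemma chains_incidence (L I : finType) (T : L -> {set I}) (U V : L -> I -> nat)
    (p1 p2 k : nat) :
  (forall l, {in T l &, forall i j, U l i < U l j -> V l i <= V l j}) ->
  (forall l, {in T l, forall i, U l i < p1}) ->
  (forall l, {in T l, forall i, V l i < p2}) ->
  (forall l l' i j i' j', i \in T l -> j \in T l -> i' \in T l' -> j' \in T l' ->
     i != j -> U l i = U l' i' -> U l j = U l' j' -> V l i = V l' i' ->
     V l j = V l' j' -> (l, i, j) = (l', i', j')) ->
  (forall l, k <= #|T l|) ->
  4 <= k -> k <= p1 -> k <= p2 ->
  #|L| * k ^ 3 <= 196 * p1 ^ 2 * p2 ^ 2.
Proof.
move=> mono_UV lt_Up lt_Vp inj_UV le_kT le4k le_kp1 le_kp2.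
(* With [4 * r <= k], a chain meets at most [k / 2] cells, so many pairs of its points share a cell.
   Widths [p %/ r + 1] make [r] blocks cover [p]. The set [X] below collects these ordered pairs of
   distinct points. *)
pose r := k %/ 4; pose w1 := (p1 %/ r).+1; pose w2 := (p2 %/ r).+1.
have r_gt0 : 0 < r by rewrite /r; lia.
pose same l i j := (U l i %/ w1 == U l j %/ w1) && (V l i %/ w2 == V l j %/ w2).
pose X := [set x : L * I * I | [&& x.1.2 \in T x.1.1, x.2 \in T x.1.1, x.1.2 != x.2
  & same x.1.1 x.1.2 x.2]].
have cell_lt p x : x < p -> x %/ (p %/ r).+1 < r.
  move=> lt_xp; rewrite ltn_divLR //; apply: leq_trans lt_xp _.
  by have := divn_eq p r; have := ltn_pmod p r_gt0; nia.
have le_kX : #|L| * k <= #|X|.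
  have -> : #|X| = \sum_l \sum_(i in T l) \sum_(j in T l) ((i != j) && same l i j).
    rewrite -sum1dep_card (eq_bigl (fun x : L * I * I => predT x.1 &&
      [&& x.1.2 \in T x.1.1, x.2 \in T x.1.1, x.1.2 != x.2 & same x.1.1 x.1.2 x.2])) //.
    rewrite big_mkcondr /=.
    rewrite -(pair_bigA _ (fun y j => if [&& y.2 \in T y.1, j \in T y.1, y.2 != j
      & same y.1 y.2 j] then 1 else 0)) /=.
    rewrite -(pair_bigA _ (fun l i => \sum_j if [&& i \in T l, j \in T l, i != j
      & same l i j] then 1 else 0)) /=.
    apply: eq_bigr => l _; rewrite [RHS]big_mkcond; apply: eq_bigr => i _.
    case: ifP => iT; last by rewrite big1.
    rewrite [RHS]big_mkcond; apply: eq_bigr => j _ /=.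
    by case: (j \in _); case: (i != j); case: (same _ _ _).
  rewrite -sum_nat_const; apply: leq_sum => l _.
  have le_T : #|T l| ^ 2 <= 2 * r * \sum_(i in T l) \sum_(j in T l) same l i j.
    apply: chain_same_cell.
    - move=> i j iT jT lt_ij; apply: leq_div2r; apply: mono_UV => //.
      by rewrite ltnNge; apply: contraL lt_ij => le_ji; rewrite -leqNgt leq_div2r.
    - by move=> i iT; apply/cell_lt/lt_Up.
    - by move=> i iT; apply/cell_lt/lt_Vp.
  have eq_sum : \sum_(i in T l) \sum_(j in T l) same l i j =
      #|T l| + \sum_(i in T l) \sum_(j in T l) ((i != j) && same l i j).
    rewrite -sum1_card -big_split; apply: eq_bigr => i iT /=.
    rewrite (bigD1 i) //= /same !eqxx [in RHS](bigD1 i) //= eqxx; congr (_ + _).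
    by apply: eq_bigr => j /andP[_ neq_ji]; rewrite (eq_sym i j) neq_ji.
  move: le_T; rewrite eq_sum; move: (\sum_(i in _) _) => N le_T.
  have := le_kT l; move: (#|T l|) le_T => t le_T le_kt.
  have : 4 * r <= k by rewrite /r; lia.
  (* With [N] such pairs on a chain of [t] points, [t ^ 2 <= 2 * r * (t + N)] and [4 * r <= t] give
     [N >= t >= k]. *)
  nia.
(* A pair of grid points lies on at most one chain, so [X] injects into the pairs of grid points in
   a common cell. *)
have le_X : #|X| <= (p1 * w1) * (p2 * w2).
  have p1_gt0 : 0 < p1 by lia.
  have p2_gt0 : 0 < p2 by lia.
  pose o1 x : 'I_p1 := insubd (Ordinal p1_gt0) x.
  pose o2 x : 'I_p2 := insubd (Ordinal p2_gt0) x.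
  have o1E x : x < p1 -> o1 x = x :> nat by move=> lt_x; rewrite val_insubd lt_x.
  have o2E x : x < p2 -> o2 x = x :> nat by move=> lt_x; rewrite val_insubd lt_x.
  pose code (x : L * I * I) := ((o1 (U x.1.1 x.1.2), o1 (U x.1.1 x.2)),
                                (o2 (V x.1.1 x.1.2), o2 (V x.1.1 x.2))).
  apply: leq_trans (leq_mul (@card_same_block p1 w1 _) (@card_same_block p2 w2 _)) => //.
  rewrite -cardsX -(card_in_imset (f := code)).
    apply/subset_leq_card/fintype.subsetP => y /imsetP[[[l i] j]]; rewrite !inE /=.
    case/and4P => iT jT _ /andP[/eqP eqU /eqP eqV] -> /=.
    by rewrite !o1E ?lt_Up // !o2E ?lt_Vp // eqU eqV !eqxx.
  move=> [[l i] j] [[l' i'] j']; rewrite !inE /=.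
  case/and4P => iT jT neq_ij _ /and4P[iT' jT' _ _] [].
  move=> /(congr1 val) /= eq1 /(congr1 val) /= eq2 /(congr1 val) /= eq3 /(congr1 val) /= eq4.
  move: eq1 eq2 eq3 eq4; rewrite !o1E ?lt_Up // !o2E ?lt_Vp // => *.
  exact: inj_UV.
have le_w p : k <= p -> r * (p * (p %/ r).+1) <= 2 * p ^ 2.
  move=> le_kp; have le_rp : r <= p by rewrite /r; lia.
  rewrite mulnCA mulnS; have := leq_trunc_div p r; nia.
have le_LX : #|L| * k * r ^ 2 <= 4 * p1 ^ 2 * p2 ^ 2.
  apply: leq_trans (_ : (p1 * w1) * (p2 * w2) * r ^ 2 <= _).
    by rewrite leq_mul2r (leq_trans le_kX le_X) orbT.
  have := leq_mul (le_w p1 le_kp1) (le_w p2 le_kp2).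
  by rewrite -/w1 -/w2; lia.
(* The extreme case is [k = 7], [r = 1]; the final constant is [196 = 4 * 7 ^ 2]. *)
have le_kr : k <= 7 * r by rewrite /r; lia.
have : #|L| * k * k ^ 2 <= #|L| * k * (49 * r ^ 2).
  by rewrite leq_mul2l -(expnMn 7 r 2) leq_sqr le_kr orbT.
lia.
Qed.

(** * From incidences to the number of shifts with many representations *)

Lemma sum_mem_le (K : choiceType) (X B : {fset K}) (h : K -> K) :
  {in X &, injective h} -> \sum_(x <- X) (h x \in B) <= #|` B|.
Proof.
move=> inj_h.
have -> : \sum_(x <- X) (h x \in B) = size [seq x <- X | h x \in B].
  by rewrite size_filter -sum1_count [RHS]big_mkcond /=; apply: eq_bigr => x _; case: (_ \in B).
rewrite -(size_map h); apply: uniq_leq_size.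
  rewrite map_inj_in_uniq ?filter_uniq ?fset_uniq // => x y.
  by rewrite !mem_filter => /andP[_ xX] /andP[_ yX]; apply: inj_h.
by move=> _ /mapP[x + ->]; rewrite mem_filter => /andP[].
Qed.

Section Rank.
Variables (d : Order.disp_t) (K : orderType d) (X : {fset K}).
Implicit Types x y : K.

(** Ranks replace the elements of an ordered set by grid coordinates below its cardinality, keeping
    their order. *)
Definition rank x := count (fun y => (y < x)%O) X.

Lemma rank_lt_card x : x \in X -> rank x < #|` X|.
Proof.
move=> xX; rewrite /rank -(count_predC (fun y => (y < x)%O) X) -addn1 leq_add2l.
by rewrite -has_count; apply/hasP; exists x; rewrite //= ltxx.
Qed.

Lemma rank_mono x y : (x <= y)%O -> rank x <= rank y.
Proof. by move=> le_xy; apply: sub_count => u /= /lt_le_trans; apply. Qed.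

Lemma rank_lt x y : x \in X -> (x < y)%O -> rank x < rank y.
Proof.
move=> xX lt_xy; rewrite /rank.
have -> : count (fun u => (u < y)%O) X = count (fun u => (u < x)%O) X +
    count (fun u => (x <= u < y)%O) X.
  elim: (enum_fset X) => //= u s ->; have [lt_ux|le_xu] := ltP u x => //=.
    by rewrite (lt_trans lt_ux lt_xy); lia.
  by lia.
rewrite -addn1 leq_add2l -has_count; apply/hasP; exists x => //=.
by rewrite lexx lt_xy.
Qed.

Lemma rank_inj : {in X &, injective rank}.
Proof.
move=> x y xX yX eq_xy; case: (ltgtP x y) => // lt_xy.
  by have := rank_lt xX lt_xy; rewrite eq_xy ltnn.
by have := rank_lt yX lt_xy; rewrite eq_xy ltnn.
Qed.
End Rank.

Section Tail.
Local Open Scope ring_scope.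
Variable R : realDomainType.
Implicit Types (A B S D : {fset R}) (z w g : R -> R).

(** The points [(z a, w a)] form a Sidon set: a difference of two distinct points determines its
    first endpoint, and the second one then follows from injectivity. *)
Definition sidon_pair z w A := forall a b a' b',
  a \in A -> b \in A -> a' \in A -> b' \in A -> a != b ->
  z a - z b = z a' - z b' -> w a - w b = w a' - w b' -> a = a'.

(* The curves are the translates by (t, g c) of the chain of the points (z a, w a): each one
   has at least k points in B * S, and by the Sidon property two of them never share two
   points. *)
Lemma tail_incr z w g A B S D (k : nat) :
  {in A &, injective z} -> {in A &, injective g} ->
  {in A &, forall a b, z a < z b -> w a < w b} -> sidon_pair z w A ->
  (forall a c, a \in A -> c \in A -> w a + g c \in S) ->
  (forall t, t \in D -> (k <= \sum_(a <- A) ((z a + t)%R \in B))%N) ->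
  (#|` A| * #|` D| * k ^ 3 <= 196 * #|` B| ^ 2 * #|` S| ^ 2)%N.
Proof.
move=> inj_z inj_g mono_zw sidon sum_S le_k.
have [->|[a0 a0A]] := fset_0Vmem A; first by rewrite cardfs0.
have [->|[t0 t0D]] := fset_0Vmem D; first by rewrite cardfs0 muln0.
have le_AS : (#|` A| <= #|` S|)%N.
  have inj : {in A &, injective (fun c => w a0 + g c)}.
    by move=> c c' cA c'A /addrI; apply: inj_g.
  apply: leq_trans (sum_mem_le S inj).
  by rewrite -sum1_size big_seq [leqRHS]big_seq; apply: leq_sum => c cA; rewrite sum_S.
have le_kA : (k <= #|` A|)%N.
  by apply: leq_trans (le_k _ t0D) _; rewrite -sum1_size; apply: leq_sum => a _; apply: leq_b1.
have le_kB : (k <= #|` B|)%N.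
  apply: leq_trans (le_k _ t0D) _; apply: sum_mem_le => a b aA bA /addIr.
  exact: inj_z.
(* The incidence bound starts at [k = 4]. For [k] from 1 to 3 each [t] in [D] is one of at most
   [#|A| * #|B|] differences, and [k ^ 3 <= 27]. *)
have [lt_k4|le_4k] := ltnP k 4.
  have [->|k_gt0] := posnP k; first by rewrite muln0.
  have le_D : (#|` D| <= #|` A| * #|` B|)%N.
    rewrite -sum1_size; apply: leq_trans (_ : \sum_(t <- D) \sum_(a <- A) ((z a + t)%R \in B) <= _)%N.
      by rewrite big_seq [leqRHS]big_seq; apply: leq_sum => t tD; apply: leq_trans (le_k t tD).
    rewrite exchange_big /= -sum1_size big_distrl /=; apply: leq_sum => a _; rewrite mul1n.
    by apply: sum_mem_le => t t' _ _ /addrI.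
  apply: leq_trans (_ : #|` A| * (#|` A| * #|` B|) * 27 <= _)%N.
    by apply: leq_mul; [rewrite leq_mul2l le_D orbT | rewrite (leq_exp2r _ 3 (isT : 0 < 3)%N)].
  have B_gt0 := leq_trans k_gt0 le_kB.
  have : (#|` A| * #|` A| <= #|` S| * #|` S|)%N by apply: leq_mul.
  have : (#|` B| <= #|` B| * #|` B|)%N by rewrite leq_pmulr.
  move: (#|` A|) (#|` B|) (#|` S|) => n b s le_b le_n.
  by have := leq_mul le_n le_b; lia.
pose T (l : D * A) := [set a : A | z (val a) + val l.1 \in B].
pose U (l : D * A) (a : A) := rank B (z (val a) + val l.1).
pose V (l : D * A) (a : A) := rank S (w (val a) + g (val l.2)).
have -> : (#|` A| * #|` D|)%N = #|{: D * A}| by rewrite card_prod !cardfE mulnC.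
have SV (l : D * A) (a : A) : w (val a) + g (val l.2) \in S by apply: sum_S; apply: valP.
apply: (@chains_incidence _ _ T U V) => //.
- move=> l i j; rewrite !inE => iB jB lt_ij.
  apply: rank_mono; rewrite lerD2r ltW // mono_zw ?(valP i) ?(valP j) //.
  rewrite ltNge; apply: contraL lt_ij => le_ji; rewrite -leqNgt.
  by apply: rank_mono; rewrite lerD2r.
- by move=> l i; rewrite inE => iB; apply: rank_lt_card.
- by move=> l i _; apply: rank_lt_card.
- move=> [t c] [t' c'] i j i' j'; rewrite !inE /= => iB jB iB' jB' neq_ij.
  move=> /(rank_inj iB iB') eq1 /(rank_inj jB jB') eq2.
  move=> /(rank_inj (SV (t, c) i) (SV (t', c') i')) /= eq3.
  move=> /(rank_inj (SV (t, c) j) (SV (t', c') j')) /= eq4.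
  have eq_z : z (val i) - z (val j) = z (val i') - z (val j').
    by have := congr2 (fun x y => x - y) eq1 eq2; rewrite /= !opprD !(addrACA _ (val _)) !subrr !addr0.
  have eq_w : w (val i) - w (val j) = w (val i') - w (val j').
    by have := congr2 (fun x y => x - y) eq3 eq4; rewrite /= !opprD !(addrACA _ (g _)) !subrr !addr0.
  have eq_i : i = i'.
    by apply/val_inj/(sidon _ _ _ _ (valP i) (valP j) (valP i') (valP j')).
  have eq_t : t = t' by apply: val_inj; move: eq1; rewrite eq_i => /addrI.
  have eq_c : c = c'.
    by apply: val_inj; move: eq3; rewrite eq_i => /addrI/inj_g; apply; apply: valP.
  have eq_j : j = j'.
    by apply: val_inj; move: eq2; rewrite eq_t => /addIr/inj_z; apply; apply: valP.
  by rewrite eq_i eq_t eq_c eq_j.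
- move=> [t c]; apply: leq_trans (le_k _ (valP t)) _.
  rewrite big_seq_fsetE /= -sum1dep_card [leqRHS]big_mkcond /=.
  by apply: leq_sum => a _; case: (_ \in B).
- exact: leq_trans le_kA le_AS.
Qed.
End Tail.

(** * Choice of the thresholds *)

(* The hypothesis on e is the case of all thresholds d; it is used at n * d ~ m ^ (3/2). *)
Lemma threshold_energy_le (n m M e : nat) : 0 < n -> n <= m -> n * M <= 196 * m ^ 4 ->
  (forall d, 0 < d -> d * e <= d * (d * (n * m)) + 8 * M) ->
  e ^ 2 <= 1572 ^ 2 * m ^ 5.
Proof.
move=> n_gt0 le_nm le_M le_e; have m_gt0 := leq_trans n_gt0 le_nm.
have exd : exists d, m ^ 3 <= (n * d) ^ 2.
  exists (m ^ 3); rewrite -mulnn; apply: leq_trans (leq_pmull _ _) _; last first.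
    by apply: leq_mul; [apply: leqnn|rewrite leq_pmull].
  by rewrite muln_gt0 n_gt0 expn_gt0 m_gt0.
case: (ex_minnP exd) => d le_d min_d.
have d_gt0 : 0 < d.
  rewrite lt0n; apply/eqP => d0; move: le_d; rewrite d0 muln0 exp0n // leqn0.
  by rewrite expn_eq0 -leqn0 leqNgt m_gt0.
(* Minimality of [d] bounds it from above: [d <= 2 * d.-1] as soon as [d > 1], which costs the
   factor 4. *)
have d_le : (n * d) ^ 2 <= 4 * m ^ 3.
  have [d1|d_gt1] := leqP d 1.
    have -> : d = 1 by lia.
    by rewrite muln1; have := leq_mul le_nm le_nm; nia.
  have : ~~ (m ^ 3 <= (n * d.-1) ^ 2).
    by apply/negP => /min_d; rewrite leqNgt prednK // leqnn.
  rewrite -ltnNge => lt_d; have : (n * d) ^ 2 <= 4 * (n * d.-1) ^ 2.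
    have -> : 4 * (n * d.-1) ^ 2 = (n * (2 * d.-1)) ^ 2 by lia.
    by rewrite leq_sqr leq_mul2l; apply/orP; right; lia.
  lia.
(* The constant is [1572 = 4 + 8 * 196]. *)
have le_ve : n * d * e <= 1572 * m ^ 4.
  have : n * (d * e) <= n * (d * (d * (n * m)) + 8 * M) by rewrite leq_mul2l le_e ?orbT.
  have -> : n * (d * (d * (n * m)) + 8 * M) = (n * d) ^ 2 * m + 8 * (n * M) by lia.
  have : (n * d) ^ 2 * m <= 4 * m ^ 3 * m by rewrite leq_mul2r d_le orbT.
  rewrite -mulnA -expnSr => le1 le2; rewrite -mulnA; lia.
rewrite -(leq_pmul2l (_ : 0 < m ^ 3)) ?expn_gt0 ?m_gt0 //.
apply: leq_trans (_ : (n * d) ^ 2 * e ^ 2 <= _); first by rewrite leq_mul2r le_d orbT.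
rewrite -expnMn; apply: leq_trans (_ : (1572 * m ^ 4) ^ 2 <= _).
  by rewrite leq_sqr.
rewrite expnMn mulnCA leq_mul2l -expnM -expnD leqnn orbT.
by [].
Qed.

(** Take the least [d] with [16 * M <= d * e]. The high part is then at most [e / 2], so the low
    part is at least [e / 2], while minimality and [e <= 16 * M] give [d * e <= 32 * M]. The
    constant is [2048 = 4 * 32 * 16]. *)
Lemma low_high_energy_le (n M l e e3 es : nat) (eh elow : nat -> nat) :
  0 < n -> 0 < M -> e <= 16 * M ->
  (forall d, e <= elow d + eh d) ->
  (forall d, 0 < d -> d * eh d <= 8 * M) ->
  (forall d, (n * elow d) ^ 2 <= d * es * e3) ->
  e3 <= 16 * M * l ->
  n ^ 2 * e ^ 3 <= 2048 * M ^ 2 * l * es.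
Proof.
move=> n_gt0 M_gt0 le_eM le_e le_eh le_el le_e3.
have [->|e_gt0] := posnP e; first by rewrite exp0n // muln0.
have exd : exists d, 16 * M <= d * e by exists (16 * M); rewrite leq_pmulr.
case: (ex_minnP exd) => d le_d min_d.
have d_gt0 : 0 < d by rewrite lt0n; apply/eqP => d0; rewrite d0 in le_d; lia.
have d_le : d * e <= 32 * M.
  have : ~~ (16 * M <= d.-1 * e).
    by apply/negP => /min_d; rewrite leqNgt prednK // leqnn.
  by rewrite -ltnNge -[X in _ -> (X * e <= _)%N](prednK d_gt0) mulSn; lia.
have le_2el : e <= 2 * elow d.
  have := le_e d; have : d * (2 * eh d) <= d * e by have := le_eh d d_gt0; lia.
  by rewrite leq_pmul2l //; lia.
have le1 : n ^ 2 * e ^ 2 <= 4 * (d * es * e3).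
  rewrite -expnMn; apply: leq_trans (_ : (2 * (n * elow d)) ^ 2 <= _).
    by rewrite leq_sqr mulnCA leq_mul2l le_2el orbT.
  by rewrite expnMn leq_mul2l le_el orbT.
have : n ^ 2 * e ^ 2 * e <= 4 * es * ((d * e) * e3).
  by have := leq_mul le1 (leqnn e); lia.
have := leq_mul d_le le_e3; rewrite -(leq_pmul2l (_ : 0 < 4)) // => le2.
have := leq_mul (leqnn es) le2; lia.
Qed.

(** * Level sets and cubic energy for monotone Sidon pairs *)

Section Energy.
Local Open Scope fset_scope.
Local Open Scope ring_scope.
Variable R : realDomainType.
Implicit Types (A B S T D Z W : {fset R}) (z w g : R -> R).

Definition strictly_monotone z w A :=
  {in A &, forall a b, z a < z b -> w a < w b} \/
  {in A &, forall a b, z a < z b -> w b < w a}.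

Lemma strictly_monotone_sym z w A : {in A &, injective z} ->
  strictly_monotone z w A -> strictly_monotone w z A.
Proof.
move=> inj_z [] mono_zw; [left|right] => a b aA bA lt_w.
  case: (ltgtP (z a) (z b)) => // [/(mono_zw _ _ bA aA)|/inj_z eq_ab].
    by rewrite ltNge ltW.
  by move: lt_w; rewrite eq_ab ?ltxx.
case: (ltgtP (z a) (z b)) => // [/(mono_zw _ _ aA bA)|/inj_z eq_ab].
  by rewrite ltNge ltW.
by move: lt_w; rewrite eq_ab ?ltxx.
Qed.

Lemma sidon_pair_sym z w A : sidon_pair z w A -> sidon_pair w z A.
Proof. by move=> sidon a b a' b' aA bA a'A b'A neq_ab eq_w eq_z; apply: (sidon a b a' b'). Qed.

Lemma card_fset_image A z : {in A &, injective z} -> #|` [fset z a | a in A]%fset| = #|` A|.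
Proof. by move=> inj_z; rewrite card_in_imfset. Qed.

(** The decreasing case becomes increasing on replacing [w], the vertical shifts [z] and [S] by
    their negatives; hence the separate map [g] in [tail_incr]. *)
Lemma tail_le z w A B S D (k : nat) :
  {in A &, injective z} -> strictly_monotone z w A -> sidon_pair z w A ->
  (forall a c, a \in A -> c \in A -> w a + z c \in S) ->
  (forall t, t \in D -> (k <= corr [fset z a | a in A] B t)%N) ->
  (#|` A| * #|` D| * k ^ 3 <= 196 * #|` B| ^ 2 * #|` S| ^ 2)%N.
Proof.
move=> inj_z mono_zw sidon sum_S le_k.
have {}le_k t : t \in D -> (k <= \sum_(a <- A) ((z a + t)%R \in B))%N.
  by move=> /le_k; rewrite /corr big_imfset.
case: mono_zw => [mono_zw|anti_zw]; first by apply: (tail_incr inj_z inj_z mono_zw sidon).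
have -> : #|` S| = #|` [fset - s | s in S]|.
  by rewrite card_fset_image // => s s' _ _; apply: oppr_inj.
apply: (@tail_incr _ z (fun a => - w a) (fun a => - z a)) => //.
- by move=> a b aA bA /oppr_inj; apply: inj_z.
- by move=> a b aA bA lt_z; rewrite ltrN2; apply: anti_zw.
- move=> a b a' b' aA bA a'A b'A neq_ab eq_z eq_w.
  apply: (sidon a b a' b') => //; apply: oppr_inj.
  by move: eq_w; rewrite !opprD.
- by move=> a c aA cA; rewrite -opprD in_imfset //= sum_S.
Qed.

Section Configuration.
Variables (z w : R -> R) (A S T : {fset R}).
Hypotheses (inj_z : {in A &, injective z}) (inj_w : {in A &, injective w}).
Hypothesis mono_zw : strictly_monotone z w A.
Hypothesis sidon : sidon_pair z w A.
Hypothesis sum_S : forall a c, a \in A -> c \in A -> w a + z c \in S.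
Let Z := [fset z a | a in A]%fset.
Let W := [fset w a | a in A]%fset.
Let n := #|` A|.
Let m := #|` S|.

(** The set [B] will be [Z] for the cubic energy and [S] for the mixed energy. *)
Lemma levels_le B (k : nat) :
  (n * (k ^ 3 * \sum_(t <- T) (k <= corr Z B t)) <= 196 * #|` B| ^ 2 * m ^ 2)%N.
Proof.
have -> : (\sum_(t <- T) (k <= corr Z B t) = #|` [fset t in T | (k <= corr Z B t)%N]|)%N.
  by rewrite -sum1_size sum_fset_sep; apply: eq_bigr => t _; rewrite muln1.
rewrite [(k ^ 3 * _)%N]mulnC mulnA.
by apply: (tail_le inj_z mono_zw sidon sum_S) => t; rewrite !inE => /andP[].
Qed.

Lemma energy_levels_le (k : nat) : (0 < n)%N ->
  (k ^ 3 * \sum_(t <- T) (k <= corr Z Z t) <= 196 * (n * m ^ 2))%N.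
Proof.
move=> n_gt0; rewrite -(leq_pmul2l n_gt0); apply: leq_trans (levels_le Z k) _.
by rewrite card_fset_image // -/n; lia.
Qed.

Lemma energy3_le : (0 < n)%N ->
  (energy3 T Z <= 8 * (196 * (n * m ^ 2)) * (trunc_log 2 n).+1)%N.
Proof.
move=> n_gt0; apply: (sum_cube_le (fun k => energy_levels_le k n_gt0)) => t.
by rewrite /n -(card_fset_image inj_z) corr_le.
Qed.
End Configuration.
End Energy.

(** * The energy bounds and the lower bound for the sumset *)

Section SumsetLowerBound.
Local Open Scope fset_scope.
Local Open Scope ring_scope.
Variable R : realDomainType.
Implicit Types (A S T : {fset R}) (z w : R -> R).
(* Variables bounded below by the actual constants keep the unary numerals out of the terms. *)
Variables K K' : nat.
Hypotheses (K_ge : (2048 * 196 ^ 2 <= K)%N) (K'_ge : (1572 ^ 2 <= K')%N).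

Section OneEnergy.
Variables (z w : R -> R) (A S T : {fset R}).
Hypotheses (inj_z : {in A &, injective z}) (inj_w : {in A &, injective w}).
Hypothesis mono_zw : strictly_monotone z w A.
Hypothesis sidon : sidon_pair z w A.
Hypothesis sum_S : forall a c, a \in A -> c \in A -> w a + z c \in S.
Hypothesis A_gt0 : (0 < #|` A|)%N.
Let Z := [fset z a | a in A].
Let W := [fset w a | a in A].
Hypothesis sub_ZZ : forall x y, x \in Z -> y \in Z -> y - x \in T.
Hypothesis sub_ZS : forall x y, x \in Z -> y \in S -> y - x \in T.
Let n := #|` A|.
Let m := #|` S|.

Lemma card_le_sumset : (n <= m)%N.
Proof.
have /fset0Pn[a0 a0A] : A != fset0 by rewrite -cardfs_gt0.
have inj : {in A &, injective (fun c => w a0 + z c)}.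
  by move=> c c' cA c'A /addrI; apply: inj_z.
apply: leq_trans (sum_mem_le S inj).
by rewrite /n -sum1_size big_seq [leqRHS]big_seq; apply: leq_sum => c cA; rewrite sum_S.
Qed.

(** Double counting turns the sum into the second moment of [corr Z S]. Below a threshold [d] this
    is at most [d] times the first moment [n * m]; above it [sum_sqr_high] applies. *)
Lemma mixed_energy_le :
  ((\sum_(t <- T) corr Z Z t * corr S S t) ^ 2 <= K' * m ^ 5)%N.
Proof.
apply: leq_trans (leq_mul K'_ge (leqnn _)).
rewrite sum_corr // -(sum_corr_sqr sub_ZS).
pose M := (196 * m ^ 4 %/ n)%N.
have tail (k : nat) : (k ^ 3 * \sum_(t <- T) (k <= corr Z S t) <= M)%N.
  rewrite leq_divRL // mulnC.
  by apply: leq_trans (levels_le T inj_z mono_zw sidon sum_S S k) _; rewrite -/m; lia.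
apply: (threshold_energy_le (M := M) A_gt0 card_le_sumset).
  by rewrite mulnC leq_trunc_div.
move=> d d_gt0; rewrite (bigID (fun t => (d <= corr Z S t)%N)) /= mulnDr addnC.
apply: leq_add; last first.
  apply: (sum_sqr_high tail (n := #|` Z|)) => // t; exact: corr_le.
rewrite leq_mul2l; apply/orP; right.
have <- : (\sum_(t <- T) corr Z S t = n * m)%N.
  by rewrite (sum_corr1 sub_ZS) card_fset_image.
rewrite big_distrr big_mkcond /=; apply: leq_sum => t _.
by rewrite -ltnNge; case: ifP => // lt_d; rewrite -mulnn leq_mul2r ltnW ?orbT.
Qed.

(** After [n ^ 2] cancels, the cube of the energy is at most a constant times [m ^ 4], the logarithm
    and the mixed energy; squaring and [mixed_energy_le] give [m ^ 13]. The bound on [W] is assumed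
    because it comes from exchanging [z] and [w]. *)
Lemma energy_le : (energy3 T W <= 8 * (196 * (n * m ^ 2)) * (trunc_log 2 n).+1)%N ->
  ((\sum_(t <- T) corr Z Z t ^ 2) ^ 6 <=
    K ^ 2 * K' * m ^ 13 * (trunc_log 2 n).+1 ^ 2)%N.
Proof.
move=> le_W.
have m_gt0 : (0 < m)%N := leq_trans A_gt0 card_le_sumset.
have le_Z := energy3_le T inj_z mono_zw sidon sum_S A_gt0.
have cardZ : #|` Z| = n by rewrite card_fset_image.
have cardW : #|` W| = n by rewrite card_fset_image.
set E := (\sum_(t <- T) _)%N; pose ES := (\sum_(t <- T) corr Z Z t * corr S S t)%N.
pose M := (196 * (n * m ^ 2))%N.
have M_gt0 : (0 < M)%N by rewrite !muln_gt0 A_gt0 m_gt0.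
have le_E : (E <= 16 * M)%N.
  apply: leq_trans (_ : n * (n * n) <= _)%N.
    rewrite -[X in (_ <= _ * (X * X))%N]cardZ -(sum_corr1 sub_ZZ) big_distrr.
    by apply: leq_sum => t _; rewrite -mulnn leq_mul2r /= -cardZ corr_le orbT.
  by have := leq_mul card_le_sumset card_le_sumset; rewrite /M; nia.
have : (n ^ 2 * E ^ 3 <= 2048 * M ^ 2 * (trunc_log 2 n).+1 * ES)%N.
  apply: (@low_high_energy_le n M _ E (energy3 T Z + energy3 T W)%N ES
    (fun d => \sum_(t <- T | (d <= corr Z Z t)%N) corr Z Z t ^ 2)
    (fun d => \sum_(t <- T | (corr Z Z t < d)%N) corr Z Z t ^ 2))%N => //.
  - move=> d; rewrite /E (bigID (fun t => (d <= corr Z Z t)%N)) /= addnC.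
    by under [X in (X + _ <= _)%N]eq_bigl do rewrite -ltnNge.
  - move=> d d_gt0; apply: (@sum_sqr_high _ _ _ M _ n) => //.
      by move=> k; apply: (energy_levels_le T inj_z mono_zw sidon sum_S).
    by move=> t; rewrite -cardZ corr_le.
  - move=> d; rewrite -{1}cardW.
    apply: leq_trans (low_energy_le (W := W) (S := S) _ sub_ZZ d) _.
      move=> _ _ /imfsetP[a /= aA ->] /imfsetP[b /= bA ->].
      by rewrite addrC sum_S.
    rewrite leq_mul2l; apply/orP; right.
    rewrite /energy3 -big_split; apply: leq_sum => t _ /=.
    (* The product [corr Z Z t ^ 2 * corr W W t] is at most the cube of the larger factor, hence at
       most the sum of both cubes. *)
    have [le_q|/ltnW le_q] := leqP (corr Z Z t) (corr W W t).
      by rewrite (leq_trans _ (leq_addl _ _)) // [leqRHS]expnSr leq_mul2r leq_sqr le_q orbT.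
    by rewrite (leq_trans _ (leq_addr _ _)) // [leqRHS]expnSr leq_mul2l le_q orbT.
  by apply: leq_trans (leq_add le_Z le_W) _; rewrite -/n -/m -/M; lia.
have -> : (2048 * M ^ 2 = n ^ 2 * (2048 * 196 ^ 2 * m ^ 4))%N.
  by rewrite /M; lia.
have := mixed_energy_le; rewrite -/Z -/ES.
move: (2048 * 196 ^ 2)%N K_ge (trunc_log 2 n).+1 => K0 le_K l le_ES.
have -> : (n ^ 2 * (K0 * m ^ 4) * l * ES = n ^ 2 * (K0 * m ^ 4 * l * ES))%N by lia.
rewrite leq_pmul2l ?expn_gt0 ?A_gt0 // => le_E3.
have -> : (E ^ 6 = (E ^ 3) ^ 2)%N by rewrite -expnM.
apply: leq_trans (_ : (K0 * m ^ 4 * l * ES) ^ 2 <= _)%N; first by rewrite leq_sqr.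
have le_sqK : (K0 ^ 2 <= K ^ 2)%N by rewrite leq_sqr.
rewrite expnMn; apply: leq_trans (leq_mul (leqnn _) le_ES) _.
have := leq_mul le_sqK (leqnn (K' * m ^ 13 * l ^ 2)%N).
by lia.
Qed.
End OneEnergy.

Lemma card_sumset_ge z w A S :
  {in A &, injective z} -> {in A &, injective w} ->
  strictly_monotone z w A -> sidon_pair z w A ->
  (forall a c, a \in A -> c \in A -> w a + z c \in S) -> (0 < #|` A|)%N ->
  (#|` A| ^ 24 <= K ^ 2 * K' * #|` S| ^ 19 *
    (trunc_log 2 #|` A|).+1 ^ 2)%N.
Proof.
move=> inj_z inj_w mono_zw sidon sum_S A_gt0.
have mono_wz := strictly_monotone_sym inj_z mono_zw.
have sidon' := sidon_pair_sym sidon.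
have sum_S' a c : a \in A -> c \in A -> z a + w c \in S.
  by move=> aA cA; rewrite addrC sum_S.
pose Z := [fset z a | a in A]; pose W := [fset w a | a in A].
(* All differences used by the configuration and by its exchange lie in this one [T], so the
   energies can be compared term by term. *)
pose V := Z `|` W `|` S; pose T := [fset y - x | x in V, y in V].
have subT x y : x \in V -> y \in V -> y - x \in T.
  by move=> xV yV; apply/imfset2P; exists x => //; exists y.
have ZV x : x \in Z -> x \in V by move=> xZ; rewrite !inE xZ.
have WV x : x \in W -> x \in V by move=> xW; rewrite !inE xW orbT.
have SV x : x \in S -> x \in V by move=> xS; rewrite !inE xS orbT.
have ZZ x y : x \in Z -> y \in Z -> y - x \in T by auto.
have ZS x y : x \in Z -> y \in S -> y - x \in T by auto.
have WW x y : x \in W -> y \in W -> y - x \in T by auto.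
have WS x y : x \in W -> y \in S -> y - x \in T by auto.
have le3Z := energy3_le T inj_z mono_zw sidon sum_S A_gt0.
have le3W := energy3_le T inj_w mono_wz sidon' sum_S' A_gt0.
have leZ := energy_le inj_z inj_w mono_zw sidon sum_S A_gt0 ZZ ZS le3W.
have leW := energy_le inj_w inj_z mono_wz sidon' sum_S' A_gt0 WW WS le3Z.
pose E := (\sum_(t <- T) corr Z Z t * corr W W t)%N.
have le_E : (#|` A| ^ 4 <= #|` S| * E)%N.
  have := @card_sumset_energy _ Z W S; rewrite -(sum_corr _ ZZ).
  rewrite !card_fset_image // mulnn -expnM; apply.
  by move=> _ _ /imfsetP[a /= aA ->] /imfsetP[b /= bA ->]; apply: sum_S'.
pose EZ := (\sum_(t <- T) corr Z Z t ^ 2)%N; pose EW := (\sum_(t <- T) corr W W t ^ 2)%N.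
(* By AM-GM the mixed energy of [Z] and [W] is at most the larger of their two energies. *)
have le_2E : (2 * E <= EZ + EW)%N.
  rewrite -big_split big_distrr /=; apply: leq_sum => t _.
  by rewrite nat_Cauchy.
have {leZ leW} : (E ^ 6 <= K ^ 2 * K' * #|` S| ^ 13 *
    (trunc_log 2 #|` A|).+1 ^ 2)%N.
  have [le_EZ|lt_EZ] := leqP E EZ; first by apply: leq_trans leZ; rewrite leq_exp2r.
  have le_EW : (E <= EW)%N by move: le_2E lt_EZ; clear; lia.
  by apply: leq_trans leW; rewrite leq_exp2r.
move: (K ^ 2 * K')%N (trunc_log 2 _).+1 => C l le_E6.
have -> : (#|` A| ^ 24 = (#|` A| ^ 4) ^ 6)%N by rewrite -expnM.
apply: leq_trans (_ : (#|` S| * E) ^ 6 <= _)%N; first by rewrite leq_exp2r.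
rewrite expnMn; apply: leq_trans (leq_mul (leqnn _) le_E6) _.
have -> : (#|` S| ^ 19 = #|` S| ^ 6 * #|` S| ^ 13)%N by rewrite -expnD.
by move: (#|` S| ^ 6)%N (#|` S| ^ 13)%N (l ^ 2)%N => x y v; clear; lia.
Qed.
End SumsetLowerBound.

Lemma card_sumset_ge_const (R : realDomainType) : exists C : nat,
  forall (z w : R -> R) (A S : {fset R}),
  {in A &, injective z} -> {in A &, injective w} ->
  strictly_monotone z w A -> sidon_pair z w A ->
  (forall a c, a \in A -> c \in A -> (w a + z c)%R \in S) -> 0 < #|` A| ->
  #|` A| ^ 24 <= C * #|` S| ^ 19 * (trunc_log 2 #|` A|).+1 ^ 2.
Proof.
have ub k : exists K, k <= K by exists k.
have [K K_ge] := ub (2048 * 196 ^ 2); have [K' K'_ge] := ub (1572 ^ 2).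
refine (ex_intro _ (K ^ 2 * K') _).
refine (card_sumset_ge K_ge K'_ge).
Qed.

(** * Sidon property and monotone parts of convex and concave functions *)

Section ConvexFunctions.
Local Open Scope ring_scope.
Variable R : realType.
Implicit Types (f : R -> R) (A : {fset R}).

(** The reflection [x + z - y] carries the weights of [y] exchanged, so the two bounds add up to
    [f y + f (x + z - y) < f x + f z]. *)
Lemma strictly_convex_lt_chord f x y z : strictly_convex f -> x < y < z ->
  exists2 t, 0 < t < 1 &
    f y < t * f x + (1 - t) * f z /\ f (x + z - y) < t * f z + (1 - t) * f x.
Proof.
move=> cvx /andP[lt_xy lt_yz].
have dxz : z - x != 0 by rewrite subr_eq0 gt_eqF // (lt_trans lt_xy).
have t01 : 0 < (z - y) / (z - x) < 1.
  have dxz_gt0 : 0 < z - x by lra.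
  by rewrite divr_gt0 ?ltr_pdivrMr //; lra.
have eq_y : y = (z - y) / (z - x) * x + (1 - (z - y) / (z - x)) * z by field.
exists ((z - y) / (z - x)) => //; split => //.
  by rewrite [in ltLHS]eq_y; apply: cvx => //; lra.
have -> : x + z - y = (z - y) / (z - x) * z + (1 - (z - y) / (z - x)) * x by field.
by apply: cvx => //; lra.
Qed.

(* The increments of f over a fixed step are strictly increasing. *)
Lemma sidon_strictly_convex f A : strictly_convex f -> sidon_pair id f A.
Proof.
move=> cvx.
have incr a b a' b' : b < a -> b < b' -> a - b = a' - b' -> f a - f b < f a' - f b'.
  move=> lt_ba lt_bb' eq_d.
  (* The point [b'] is the reflection of [a] in the interval from [b] to [a']. *)
  have lt_a : b < a < a' by apply/andP; split; lra.
  have [t _ [lt1]] := strictly_convex_lt_chord cvx lt_a.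
  have -> : b + a' - a = b' by lra.
  lra.
have neq a b a' b' : b < a -> a - b = a' - b' -> f a - f b = f a' - f b' -> a = a'.
  move=> lt_ba eq_d eq_f; case: (ltgtP b b') => [lt_b|lt_b|]; last by lra.
    by have := incr _ _ _ _ lt_ba lt_b eq_d; lra.
  have lt_ba' : b' < a' by lra.
  by have := incr _ _ _ _ lt_ba' lt_b (esym eq_d); lra.
move=> a b a' b' _ _ _ _ neq_ab eq_d eq_f; case: (ltgtP b a) neq_ab => // lt_ab _.
  exact: neq lt_ab eq_d eq_f.
have eq_b : b = b' by apply: (neq b a b' a') => //; lra.
lra.
Qed.

(** Cut [A] at a point [a0] where [f] is minimal on [A] and keep the larger side. Since it is
    nonempty, [#|A| <= 2 * #|A'| + 1] is below [4 * #|A'|]. A value strictly below a chord from the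
    minimum to a farther point is below the value at that point. *)
Lemma strictly_convex_monotone_part f A : strictly_convex f -> (2 <= #|` A|)%N ->
  exists A' : {fset R}, [/\ {subset A' <= A}, (#|` A| <= 4 * #|` A'|)%N &
    strictly_monotone id f A'].
Proof.
move=> cvx A_ge2.
have /fset0Pn[a1 a1A] : A != fset0 by rewrite -cardfs_gt0; lia.
have [a0 a0A min_a0] : exists2 a0, a0 \in A & forall a, a \in A -> f a0 <= f a.
  case: (arg_minP (fun a : A => f (val a)) (i0 := [` a1A]%fset) (P := xpredT)) => // a0 _ min_a0.
  by exists (val a0); [exact: valP | move=> a aA; apply: (min_a0 [` aA]%fset)].
pose Ar := [fset a in A | a0 < a]%fset; pose Al := [fset a in A | a < a0]%fset.
have cardA : (#|` A| <= #|` Al| + #|` Ar| + 1)%N.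
  have -> : A = (Al `|` Ar `|` [fset a0])%fset.
    apply/fsetP => a; rewrite !inE /=; case: (ltgtP a a0) => [||->];
      by rewrite ?andbT ?andbF ?orbF ?orbT ?a0A.
  by apply: leq_trans (leq_card_fsetU _ _) _; rewrite cardfs1 leq_add2r leq_card_fsetU.
have [le_card|lt_card] := leqP #|` Al| #|` Ar|.
  exists Ar; split; [by move=> a; rewrite !inE => /andP[]| by lia|left].
  move=> a b; rewrite !inE /= => /andP[_ lt_a] /andP[bA _] lt_ab.
  have lt0 : a0 < a < b by rewrite lt_a.
  have [t t01 [lt_fa _]] := strictly_convex_lt_chord cvx lt0.
  by have := min_a0 b bA; nra.
exists Al; split; [by move=> a; rewrite !inE => /andP[]| by lia|right].
move=> a b; rewrite !inE /= => /andP[aA _] /andP[_ lt_b] lt_ab.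
have lt0 : a < b < a0 by rewrite lt_ab.
have [t t01 [lt_fb _]] := strictly_convex_lt_chord cvx lt0.
by have := min_a0 a aA; nra.
Qed.

(** Passing from [f] to [- f] reduces concave to convex: it swaps the two directions of monotonicity
    and keeps the Sidon property. *)
Lemma monotone_sidon_part f A : strictly_convex f \/ strictly_concave f ->
  (2 <= #|` A|)%N ->
  exists A' : {fset R}, [/\ {subset A' <= A}, (#|` A| <= 4 * #|` A'|)%N,
    strictly_monotone id f A' & sidon_pair id f A'].
Proof.
case=> [cvx|ccv] A_ge2.
  have [A' [sA' cardA' mono]] := strictly_convex_monotone_part cvx A_ge2.
  by exists A'; split=> //; apply: sidon_strictly_convex.
have cvx : strictly_convex (fun x => - f x).
  by move=> x y t neq_xy t01; have := ccv x y t neq_xy t01; lra.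
have [A' [sA' cardA' mono]] := strictly_convex_monotone_part cvx A_ge2.
exists A'; split=> //.
  case: mono => mono; [right|left] => a b aA bA lt_ab;
  by have := mono a b aA bA lt_ab; rewrite ltrN2.
move=> a b a' b' aA bA a'A b'A neq_ab eq_d eq_f.
by apply: (sidon_strictly_convex cvx aA bA a'A b'A neq_ab eq_d); lra.
Qed.

Lemma strictly_monotone_inj f A : strictly_monotone id f A -> {in A &, injective f}.
Proof.
by case=> mono a b aA bA eq_f; case: (ltgtP a b) => // lt_ab;
  [have := mono a b aA bA lt_ab | have := mono b a bA aA lt_ab
  |have := mono a b aA bA lt_ab | have := mono b a bA aA lt_ab]; rewrite eq_f ltxx.
Qed.
End ConvexFunctions.

(** * Passage to real logarithms and exponents *)

(** The factor 2 absorbs the successor, because the logarithm is at least 1 for [n >= 2]. *)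
Lemma trunc_log_le_log2 (R : realType) (n : nat) : (2 <= n)%N ->
  ((trunc_log 2 n).+1%:R <= 2 * log2 (n%:R : R))%R.
Proof.
move=> n_ge2.
have log_gt0 : (1 <= trunc_log 2 n)%N by rewrite trunc_log_gt0.
have ln2_gt0 : (0 < ln (2 : R))%R by rewrite ln_gt0 // ltr1n.
have : ((trunc_log 2 n)%:R <= log2 (n%:R : R))%R.
  rewrite /log2 ler_pdivlMr // mulrC mulr_natr -lnXn // ler_ln ?posrE ?exprn_gt0 //; last first.
    by rewrite ltr0n; lia.
  by rewrite -natrX ler_nat trunc_logP //; lia.
have : (1 <= (trunc_log 2 n)%:R :> R)%R by rewrite ler1n.
by rewrite -natr1; lra.
Qed.

Local Open Scope ring_scope.
Theorem theorem1p3 (R : realType) :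
  exists c : R, 0 < c /\
    forall (f : R -> R) (A : {fset R}),
      continuous f ->
      strictly_convex f \/ strictly_concave f ->
      (2 <= #|` A|)%N ->
      c * ((#|` A|%:R : R) `^ (24 / 19) / (log2 (#|` A|%:R : R)) `^ (2 / 19))
        <= #|` sumset A (image_fset f A)|%:R.
Proof.
have [K card_S] := card_sumset_ge_const R.
(* The loss from [#|A| <= 4 * #|A'|], raised to the power 24. *)
pose D : R := 4 ^+ 24.
have D_gt0 : 0 < D by rewrite exprn_gt0.
(* The factor 4 is the square of the 2 in [trunc_log_le_log2]; adding 1 makes [C] positive even for
   [K = 0]. *)
pose C : R := D * K%:R * 4 + 1.
have C_gt0 : 0 < C by rewrite ltr_wpDl ?mulr_ge0 // ltW.
have powR19 (a b : R) : 0 <= a -> (a `^ (b / 19)) ^+ 19 = a `^ b.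
  by move=> a_ge0; rewrite -powR_mulrn ?powR_ge0 // -powRrM divfK.
exists (C^-1 `^ (1 / 19)); split; first by rewrite powR_gt0 ?invr_gt0.
move=> f A _ cvx A_ge2.
set S := sumset A _; set n := #|` A|; set m := #|` S|.
pose L : R := log2 (n%:R : R); rewrite -/L.
have le_lL : (trunc_log 2 n).+1%:R <= 2 * L := trunc_log_le_log2 R A_ge2.
have L_gt0 : 0 < L.
  by have : (0 : R) < (trunc_log 2 n).+1%:R by []; lra.
have [A' [sA' cardA' mono sidon]] := monotone_sidon_part cvx A_ge2.
pose n' := #|` A'|.
have n'_gt0 : (0 < n')%N by move: A_ge2 cardA'; rewrite -/n' -/n; lia.
have le_n'n : (n' <= n)%N.
  by apply/fsubset_leq_card/fsubsetP.
have sum_S a b : a \in A' -> b \in A' -> f a + id b \in S.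
  move=> aA bA; apply/imfset2P; exists b; rewrite /= ?sA' //.
  by exists (f a); [rewrite /= in_imfset //= sA' | rewrite addrC].
have inj_id : {in A' &, injective (id : R -> R)} by [].
have le_n' := card_S id f A' S inj_id
  (strictly_monotone_inj mono) mono sidon sum_S n'_gt0.
have main : n%:R ^+ 24 <= C * L ^+ 2 * m%:R ^+ 19.
  have le_n : (n%:R : R) ^+ 24 <= D * n'%:R ^+ 24.
    rewrite -exprMn lerXn2r ?nnegrE ?mulr_ge0 //.
    by rewrite -natrM ler_nat.
  apply: le_trans le_n _.
  have le_log : (trunc_log 2 n').+1%:R ^+ 2 <= 4 * L ^+ 2.
    have -> : 4 * L ^+ 2 = (2 * L) ^+ 2 by ring.
    rewrite lerXn2r ?nnegrE //; first by lra.
    by apply: le_trans le_lL; rewrite ler_nat ltnS leq_trunc_log.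
  have : n'%:R ^+ 24 <= K%:R * m%:R ^+ 19 * (trunc_log 2 n').+1%:R ^+ 2 :> R.
    by rewrite -!natrX -!natrM ler_nat.
  have Km_ge0 : 0 <= K%:R * m%:R ^+ 19 :> R by rewrite mulr_ge0.
  move/le_trans/(_ (ler_wpM2l Km_ge0 le_log))/(ler_wpM2l (ltW D_gt0))/le_trans; apply.
  rewrite /C; have : 0 <= L ^+ 2 * m%:R ^+ 19 by rewrite mulr_ge0 ?exprn_ge0 // ltW.
  move: (_%:R ^+ 19) (L ^+ 2) => x y; lra.
(* Raising both sides to the power 19 clears all fractional exponents and leaves [main]; hence the
   exponent [1 / 19] in the witness. *)
rewrite -(@ler_pXn2r _ 19) ?nnegrE ?mulr_ge0 ?invr_ge0 ?powR_ge0 //.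
have C_inv_ge0 : 0 <= C^-1 by rewrite invr_ge0 ltW.
rewrite 2!exprMn exprVn !powR19 ?(ltW L_gt0) // powRr1 //.
rewrite !powR_mulrn ?(ltW L_gt0) // mulrCA -invfM ler_pdivrMr; last first.
  by rewrite mulr_gt0 ?exprn_gt0.
by rewrite mulrC.
Qed.
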